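(* Let $K$ be a field, $(H,\tau)$ a finite-dimensional Frobenius $K$-algebra for which $K$ is a splitting field, with Nakayama automorphism $\alpha$. Let $P$ be a projective indecomposable right $H$-module with socle $S=\mathrm{soc}(P)$ and head $V=P/\mathrm{rad}(P)$, put $d=\dim_K V=\dim_K S$, $n=\dim_K P$, $m=n-d$, and let $(b_i)_{i=1}^n$ be an adapted basis of $P$ (as defined in the context). Let $(B_w)_{w\in W}$ be any $K$-basis of $H$ with dual basis $(B_w^\vee)_{w\in W}$. Put $$c:=\sum_{w\in W} b_1^*(b_1B_w)\, b_1^*(b_{1+m}B_w^\vee)\in K .$$ Then $c\neq 0$, and there is a polynomial $f\in\mathbb{Z}[X]$ such that both of the following hold. (Explicitly, one may take $f=\sum_{s=0}^{a}\binom{2a}{s}X^{2a-s}(1-X)^s$, where $a$ is a positive integer with $(\mathrm{rad}(H))^a=0$.) (1) For $i\in\{1,\ldots,d\}$ set $\tilde e_i:=c^{-1}\sum_{w\in W} b_i^*(b_{i+m}B_w)\,B_w^\vee$ and $e_i:=f(\tilde e_i)$. Then for all $i,i'\in\{1,\ldots,d\}$ with $i\neq i'$: $$e_i^2=e_i,\qquad e_iH\cong P,\qquad e_ie_{i'}\in\mathrm{rad}(H).$$ (2) For $i\in\{1,\ldots,d\}$ set $\tilde E_i:=c^{-1}\sum_{w\in W} b_i^*(b_{i+m}B_w^\vee)\,B_w$ and $E_i:=f(\tilde E_i)$. Let $\bar P$ be a projective indecomposable right $H$-module whose head is isomorphic to $S$. Then for all $i,i'\in\{1,\ldots,d\}$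 with $i\neq i'$: $$E_i^2=E_i,\qquad E_iH\cong\bar P,\qquad E_iE_{i'}\in\mathrm{rad}(H).$$
   Context: $K$ is a field; algebras are associative with $1$; all modules are finite-dimensional right modules. A Frobenius algebra $(H,\tau)$ is a finite-dimensional $K$-algebra $H$ with a $K$-linear map $\tau:H\to K$ such that the bilinear form $(a,b)\mapsto\tau(ab)$ is non-degenerate. For a $K$-basis $(B_w)_{w\in W}$ of $H$, the dual basis $(B_w^\vee)_{w\in W}$ is the unique basis with $\tau(B_y^\vee B_w)=\delta_{y,w}$ for all $y,w\in W$. The Nakayama automorphism $\alpha$ is the unique algebra automorphism of $H$ with $\tau(ab)=\tau(\alpha(b)a)$ for all $a,b\in H$. For a projective indecomposable $P$, the socle $S$ and head $V$ are simple, and $V\cong S^{\alpha^{-1}}$ (the module with underlying space $S$ and action $l\ast h=l\,\alpha^{-1}(h)$), so $\dim S=\dim V=d$. For a basis $(b_i)_{i=1}^n$ of $P$, $(b_i^* )_{i=1}^n$ denotes the dual basis of $\mathrm{Hom}_K(P,K)$, i.e. $b_i^*(b_j)=\delta_{i,j}$. The basis is called adapted if: $(b_1,\ldots,b_d)$ is a basis of $S$; $(b_1,\ldots,b_m)$ is a basis of $\mathrm{rad}(P)$, where $m=n-d$; and $b_i^*(b_jh)=b_{m+i}^*(b_{m+j}\,\alpha(h))$ for all $h\in H$ and all $i,j\in\{1,\ldots,d\}$. *)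

(* Defs.v *)
From HB Require Import structures.
From mathcomp Require Import all_boot all_order all_algebra.
From mathcomp Require Import falgebra boolp.

Set Implicit Arguments.
Unset Strict Implicit.
Unset Printing Implicit Defensive.

Import GRing.Theory.
Local Open Scope ring_scope.

Section VspaceInf.
Variables (K : fieldType) (vT : vectType K).
Implicit Types (Q : {vspace vT} -> Prop) (U X : {vspace vT}).

Lemma vinf_exists Q :
  exists X, forall v, v \in X <-> (forall U, Q U -> v \in U).
Proof.
suff H n : forall Y, (\dim Y <= n)%N ->
    (forall v, (forall U, Q U -> v \in U) -> v \in Y) ->
    exists X, forall v, v \in X <-> (forall U, Q U -> v \in U).
  by apply: (H (\dim {:vT}) fullv) => // v _; rewrite memvf.
elim: n => [|n IHn] Y dY sY.
  exists Y => v; split=> [vY U _|]; last exact: sY.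
  move: dY vY; rewrite leqn0 dimv_eq0 => /eqP->.
  by rewrite memv0 => /eqP->; rewrite mem0v.
have [[U [QU nYU]]|noU] := pselect (exists U, Q U /\ ~~ (Y <= U)%VS).
  apply: (IHn (Y :&: U)%VS).
    have neq : (Y :&: U)%VS != Y by apply: contra nYU => /eqP<-; exact: capvSr.
    move: neq; rewrite eqEdim capvSl /= -ltnNge => ltd.
    by rewrite -ltnS; apply: leq_trans ltd dY.
  by move=> v hv; rewrite memv_cap sY // hv.
exists Y => v; split=> [vY U QU|]; last exact: sY.
apply: (subvP _ _ vY); case: (boolP (Y <= U)%VS) => // nYU.
by case: noU; exists U.
Qed.

(* Intersection and sum of a possibly infinite family Q of subspaces. *)
Definition vinf Q : {vspace vT} := projT1 (cid (vinf_exists Q)).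
Definition vsup Q : {vspace vT} := vinf (fun X => forall U, Q U -> (U <= X)%VS).

Lemma vinfP Q v : v \in vinf Q <-> (forall U, Q U -> v \in U).
Proof. exact: (projT2 (cid (vinf_exists Q)) v). Qed.

Lemma vsup_ub Q U : Q U -> (U <= vsup Q)%VS.
Proof.
by move=> QU; apply/subvP=> v vU; apply/vinfP=> X /(_ U QU)/subvP; apply.
Qed.

Lemma vsup_le Q X : (forall U, Q U -> (U <= X)%VS) -> (vsup Q <= X)%VS.
Proof. by move=> h; apply/subvP=> v /vinfP/(_ X); apply. Qed.

End VspaceInf.

(* MathComp only has left modules; these are the finite-dimensional right
   modules over the finite-dimensional K-algebra H. *)
Record rmod (K : fieldType) (H : falgType K) := RMod {
  rmod_sort :> vectType K;
  ract : rmod_sort -> H -> rmod_sort;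
  ract_linearl : forall h, linear (ract^~ h);
  ract_linearr : forall x, linear (ract x);
  ract1 : forall x, ract x 1 = x;
  ractM : forall x g h, ract x (g * h) = ract (ract x g) h
}.

Arguments ract {K H M} x h : rename.

Notation "x *> h" := (ract x h) (at level 40, left associativity) : ring_scope.

Section RightModules.
Variables (K : fieldType) (H : falgType K).
Implicit Types M N : rmod H.

Definition ractr M (h : H) (x : M) : M := x *> h.

HB.instance Definition _ M h := GRing.isSemilinear.Build K M M _ (@ractr M h)
  (GRing.semilinear_linear (@ract_linearl K H M h)).

Record submod M := Submod {
  submod_space :> {vspace M};
  submodP : forall x h, x \in submod_space -> x *> h \in submod_space
}.

Definition is_rhom M N (f : 'Hom(M, N)) := forall x h, f (x *> h) = f x *> h.

Definition riso M N := exists f : 'Hom(M, N), is_rhom f /\ bijective f.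

Section SubModule.
Variables (M : rmod H) (U : submod M).

Definition rsub_act (x : subvs_of U) (h : H) : subvs_of U :=
  Subvs (submodP h (subvsP x)).

Fact rsub_linearl h : linear (rsub_act^~ h).
Proof. by move=> a x y; apply: val_inj; rewrite /= ract_linearl. Qed.
Fact rsub_linearr x : linear (rsub_act x).
Proof. by move=> a g h; apply: val_inj; rewrite /= ract_linearr. Qed.
Fact rsub_act1 x : rsub_act x 1 = x.
Proof. by apply: val_inj; rewrite /= ract1. Qed.
Fact rsub_actM x g h : rsub_act x (g * h) = rsub_act (rsub_act x g) h.
Proof. by apply: val_inj; rewrite /= ractM. Qed.

Definition rsub : rmod H :=
  RMod rsub_linearl rsub_linearr rsub_act1 rsub_actM.

End SubModule.

(* The quotient M / U is carried by the chosen linear complement U^C, with the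
   action transported along the projection onto U^C with kernel U. *)
Section QuotModule.
Variables (M : rmod H) (U : submod M).

Definition rquot_proj : 'Hom(M, subvs_of (U^C)%VS) :=
  linfun (vsproj (U^C)%VS \o daddv_pi (U^C)%VS U).

Definition rquot_act (x : subvs_of (U^C)%VS) (h : H) : subvs_of (U^C)%VS :=
  rquot_proj (vsval x *> h).

Lemma rquot_projK x : vsval (rquot_proj x) - x \in submod_space U.
Proof.
rewrite lfunE /= vsprojK ?memv_pi // -memvN opprB.
have capUC : (U^C :&: U = 0)%VS by rewrite capvC capv_compl.
have xUC : (x \in U^C + U)%VS by rewrite addvC addv_complf memvf.
by rewrite -{1}[x](daddv_pi_add capUC xUC) addrC addKr memv_pi.
Qed.

Lemma rquot_proj_val x : rquot_proj (vsval x) = x.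
Proof.
rewrite lfunE /= daddv_pi_id ?subvsP ?vsvalK //.
by rewrite capvC capv_compl.
Qed.

Lemma rquot_proj_eq0 x : (rquot_proj x == 0) = (x \in submod_space U).
Proof.
apply/eqP/idP=> [x0|xU].
  by have := rquot_projK x; rewrite x0 linear0 sub0r memvN.
apply: val_inj; rewrite /=; apply/eqP.
rewrite -memv0 -(capv_compl U) memv_cap subvsP andbT.
by rewrite -(subrK x (vsval _)) memvD ?rquot_projK.
Qed.

Lemma rquot_projE x h : rquot_proj (x *> h) = rquot_act (rquot_proj x) h.
Proof.
apply/eqP; rewrite eq_sym -subr_eq0 -linearB rquot_proj_eq0.
rewrite -[_ *> h - _](linearB (@ractr M h)).
by rewrite /ractr submodP // rquot_projK.
Qed.

Fact rquot_linearl h : linear (rquot_act^~ h).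
Proof.
by move=> a x y; rewrite /rquot_act linearP /= ract_linearl linearP.
Qed.
Fact rquot_linearr x : linear (rquot_act x).
Proof. by move=> a g h; rewrite /rquot_act ract_linearr linearP. Qed.
Fact rquot_act1 x : rquot_act x 1 = x.
Proof. by rewrite /rquot_act ract1 rquot_proj_val. Qed.
Fact rquot_actM x g h : rquot_act x (g * h) = rquot_act (rquot_act x g) h.
Proof. by rewrite /rquot_act ractM rquot_projE. Qed.

Definition rquot : rmod H :=
  RMod rquot_linearl rquot_linearr rquot_act1 rquot_actM.

End QuotModule.

Definition rsimple M :=
  fullv != 0%VS :> {vspace M} /\
  forall U : submod M, U = 0%VS :> {vspace M} \/ U = fullv :> {vspace M}.

Definition rmaximal M (U : submod M) :=
  U != fullv :> {vspace M} /\
  forall X : submod M, (U <= X)%VS ->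
    X = U :> {vspace M} \/ X = fullv :> {vspace M}.

Definition rindecomposable M :=
  fullv != 0%VS :> {vspace M} /\
  forall U X : submod M, (U + X = fullv)%VS -> (U :&: X = 0)%VS ->
    U = 0%VS :> {vspace M} \/ X = 0%VS :> {vspace M}.

Definition rprojective M :=
  forall (N1 N2 : rmod H) (p : 'Hom(N1, N2)) (f : 'Hom(M, N2)),
    is_rhom p -> limg p = fullv -> is_rhom f ->
    exists2 g : 'Hom(M, N1), is_rhom g & (p \o g)%VF = f.

Section RadicalSocle.
Variable M : rmod H.

Definition is_simple_sub (U : {vspace M}) :=
  exists2 X : submod M, rsimple (rsub X) & U = X.
Definition is_maximal_sub (U : {vspace M}) :=
  exists2 X : submod M, rmaximal X & U = X.

Fact rsoc_subproof x h :
  x \in vsup is_simple_sub -> x *> h \in vsup is_simple_sub.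
Proof.
suff /subvP s : (vsup is_simple_sub <=
    linfun (@ractr M h) @^-1: vsup is_simple_sub)%VS.
  by move=> /s; rewrite -memv_preim lfunE.
apply: vsup_le => U simU; apply/subvP=> y yU; rewrite -memv_preim lfunE /=.
apply: (subvP (vsup_ub simU)); case: simU yU => X _ ->; exact: submodP.
Qed.

Definition rsoc : submod M := Submod rsoc_subproof.

Fact rrad_subproof x h :
  x \in vinf is_maximal_sub -> x *> h \in vinf is_maximal_sub.
Proof.
move=> /vinfP xR; apply/vinfP=> U maxU; have := xR U maxU.
by case: maxU => X _ ->; exact: submodP.
Qed.

Definition rrad : submod M := Submod rrad_subproof.

Definition rhead : rmod H := rquot rrad.

End RadicalSocle.

Fact regular_linearl (h : H) : linear (fun x : H => x * h).
Proof. by move=> a x y; rewrite mulrDl scalerAl. Qed.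
Fact regular_linearr (x : H) : linear (fun h : H => x * h).
Proof. by move=> a g h; rewrite mulrDr scalerAr. Qed.

Definition regular : rmod H :=
  @RMod K H H *%R regular_linearl regular_linearr (@mulr1 H) (@mulrA H).

Fact rideal_subproof (e : H) (x : regular) (h : H) :
  x \in limg (amull e) -> x *> h \in limg (amull e).
Proof.
case/memv_imgP=> y _ ->; apply/memv_imgP; exists (y * h); first exact: memvf.
by rewrite !lfunE /= mulrA.
Qed.

Definition rideal (e : H) : submod regular :=
  @Submod regular (limg (amull e)) (@rideal_subproof e).

(* The submodules of regular are the right ideals, so this is the Jacobson
   radical of H. *)
Definition jrad : {vspace H} := rrad regular.

Definition splitting_field :=
  forall M, rsimple M -> forall f : 'Hom(M, M), is_rhom f ->
  exists k : K, forall x : M, f x = k *: x.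

Definition frobenius_form (tau : {scalar H}) :=
  (forall a, (forall b, tau (a * b) = 0) -> a = 0) /\
  (forall b, (forall a, tau (a * b) = 0) -> b = 0).

Definition nakayama_automorphism (tau : {scalar H})
    (alpha : {lrmorphism H -> H}) :=
  bijective alpha /\ forall a b, tau (a * b) = tau (alpha b * a).

Definition basis_family (W : finType) (B : W -> H) :=
  basis_of {:H} (codom B).

Definition dual_basis (tau : {scalar H}) (W : finType) (B Bd : W -> H) :=
  basis_family Bd /\ forall y w, tau (Bd y * B w) = (y == w)%:R.

End RightModules.

(* Indices are 0-based: for i < d, lo_idx m i and hi_idx m i are the positions
   i and m + i in a basis of length m + d; coord b i is the dual basis vector. *)
Definition lo_idx m d (i : 'I_d) : 'I_(m + d) := widen_ord (leq_addl m d) i.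
Definition hi_idx m d (i : 'I_d) : 'I_(m + d) := rshift m i.

Definition adapted_basis (K : fieldType) (H : falgType K) (alpha : H -> H)
    (P : rmod H) m d (b : (m + d).-tuple P) :=
  [/\ basis_of {:P} b,
      basis_of (rsoc P) (take d b),
      basis_of (rrad P) (take m b)
    & forall (h : H) (i j : 'I_d),
        coord b (lo_idx m i) (tnth b (lo_idx m j) *> h) =
        coord b (hi_idx m i) (tnth b (hi_idx m j) *> alpha h)].

Definition poly_eval (A : nzRingType) (f : {poly int}) (x : A) : A :=
  (map_poly intr f).[x].

Definition lift_poly (a : nat) : {poly int} :=
  \sum_(0 <= s < a.+1) ('X^(2 * a - s) * (1 - 'X) ^+ s) *+ 'C(2 * a, s).

(* Main.v *)
(* Write theta l : P -> H for the right linear map with tau (theta l p * h) =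
   l (p h), where l is a linear form on P; the element e'_i is the multiple by
   c^-1 of theta b_i^* (b_(m+i)), and alpha (E'_i) = e'_i. The adapted basis
   gives a linear map T : P -> P with kernel rad P and image soc P such that
   T (p alpha(h)) = T p h. By Schur's lemma, p |-> u theta l p is a scalar
   lambda (u, l) on the head of P, and expanding with the dual bases yields
   lambda (u, l) * k (T p) = l (p theta k (T u)). Hence
   u theta l p = c * l (T u) * p modulo rad P. Since P is projective, the
   surjection h |-> b_(m+1) h from H to P has a section, which is some theta l;
   this forces c != 0. As theta l maps rad P to rad H, it follows that
   e'_i e'_j = delta_ij e'_i modulo rad H, and the polynomial f lifts the e'_i
   to idempotents e_i. The map q |-> b_(m+i) q from e_i H to P is onto because
   P is local, and e_i H lies in the image of P under theta, so that
   e_i H and P are isomorphic by a dimension count. For part (2), the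
   automorphism alpha transports everything except the isomorphism with Pbar,
   for which one lifts Pbar -> soc P through h |-> b_i h to bound dim P by
   dim Pbar. *)
Require Import Defs.
From HB Require Import structures.
From mathcomp Require Import all_boot all_order all_algebra.
From mathcomp Require Import falgebra boolp ring.

Set Implicit Arguments.
Unset Strict Implicit.
Unset Printing Implicit Defensive.

Import GRing.Theory.
Local Open Scope ring_scope.

(** * Local modules *)

(** Classical minimisation over a predicate in [Prop]; it selects submodules of extremal
    dimension. *)
Lemma ex_argmin (T : Type) (m : T -> nat) (Q : T -> Prop) :
  (exists x, Q x) -> exists2 x, Q x & forall y, Q y -> (m x <= m y)%N.
Proof.
case=> x0 Qx0.
have exP : exists k, `[< exists2 x, Q x & m x = k >].
  by exists (m x0); apply/asboolP; exists x0.
case: (ex_minnP exP) => k /asboolP[x Qx mx] kmin.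
by exists x => // y Qy; rewrite mx; apply: kmin; apply/asboolP; exists y.
Qed.

Section RightModuleTheory.
Variables (K : fieldType) (H : falgType K).
Implicit Types (M N P : rmod H).

HB.instance Definition _ M (x : M) := GRing.isSemilinear.Build K H M _ (ract x)
  (GRing.semilinear_linear (ract_linearr x)).

Lemma ractZl M a (x : M) h : (a *: x) *> h = a *: (x *> h).
Proof. exact: (linearZ_LR (ractr h)). Qed.

Lemma ractBl M (x y : M) h : (x - y) *> h = x *> h - y *> h.
Proof. exact: (linearB (ractr h)). Qed.

Lemma ractDl M (x y : M) h : (x + y) *> h = x *> h + y *> h.
Proof. exact: (linearD (ractr h)). Qed.

Lemma ract0l M h : (0 : M) *> h = 0.
Proof. exact: (linear0 (ractr h)). Qed.

Lemma ract_suml M (I : finType) (x : I -> M) h :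
  (\sum_i x i) *> h = \sum_i x i *> h.
Proof. exact: (linear_sum (ractr h)). Qed.

Fact zero_subproof M (x : M) (h : H) :
  x \in 0%VS -> x *> h \in (0%VS : {vspace M}).
Proof. by rewrite !memv0 => /eqP->; rewrite ract0l. Qed.

Definition zero_submod M : submod M := Submod (@zero_subproof M).

Fact full_subproof M (x : M) (h : H) :
  x \in fullv -> x *> h \in (fullv : {vspace M}).
Proof. by rewrite !memvf. Qed.

Definition full_submod M : submod M := Submod (@full_subproof M).

Fact add_subproof M (U X : submod M) (x : M) (h : H) :
  x \in (U + X)%VS -> x *> h \in (U + X)%VS.
Proof.
by case/memv_addP=> y yU [z zX ->]; rewrite ractDl memv_add ?submodP.
Qed.

Definition add_submod M (U X : submod M) : submod M :=
  Submod (@add_subproof M U X).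

Section Hom.
Variables (M N : rmod H) (f : 'Hom(M, N)) (fH : is_rhom f).

Fact preim_subproof (X : submod N) (x : M) (h : H) :
  x \in (f @^-1: X)%VS -> x *> h \in (f @^-1: X)%VS.
Proof. by rewrite -!memv_preim fH; exact: submodP. Qed.

Definition preim_submod (X : submod N) : submod M :=
  Submod (@preim_subproof X).

Fact img_subproof (X : submod M) (y : N) (h : H) :
  y \in (f @: X)%VS -> y *> h \in (f @: X)%VS.
Proof.
by case/memv_imgP=> x xX ->; rewrite -fH memv_img // submodP.
Qed.

Definition img_submod (X : submod M) : submod N := Submod (@img_subproof X).

End Hom.

Definition orbit_map M (x : M) : 'Hom(regular H, M) := linfun (ract x).

Lemma orbit_mapE M (x : M) h : orbit_map x h = x *> h.
Proof. by rewrite lfunE. Qed.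

Lemma orbit_map_rhom M (x : M) : is_rhom (orbit_map x).
Proof. by move=> g h; rewrite !orbit_mapE ractM. Qed.

Lemma rrad_max M (X : submod M) : rmaximal X -> (rrad M <= X)%VS.
Proof. by move=> Xmax; apply/subvP=> x /vinfP; apply; exists X. Qed.

(** The preimage of a maximal submodule [X] is everything or again maximal: for [Y] above it,
    maximality of [X] leaves only two values for [X + f(Y)], and these force [Y] to be the preimage
    or all of [M]. *)
Lemma rhom_rad M N (f : 'Hom(M, N)) x :
  is_rhom f -> x \in (rrad M : {vspace M}) -> f x \in (rrad N : {vspace N}).
Proof.
move=> fH xR; apply/vinfP=> _ [X [Xn Xmax] ->].
have [fX|nfX] := eqVneq (f @^-1: X)%VS fullv.
  by rewrite memv_preim fX memvf.
suff /rrad_max/subvP/(_ _ xR) : rmaximal (preim_submod fH X).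
  by rewrite -memv_preim.
split=> // Y leY.
have le_Xadd : (X <= add_submod X (img_submod fH Y))%VS by exact: addvSl.
have [XE|XE] := Xmax _ le_Xadd.
  left; apply/eqP; rewrite eqEsubv leY andbT; apply/subvP=> y yY.
  by rewrite -memv_preim -XE (subvP (addvSr _ _)) // memv_img.
right; apply/eqP; rewrite eqEsubv subvf; apply/subvP=> y _.
have : f y \in (add_submod X (img_submod fH Y) : {vspace N}) by rewrite XE memvf.
case/memv_addP=> z zX [_ /memv_imgP[w wY ->] fyE].
rewrite -(subrK w y) memvD // (subvP leY) // -memv_preim linearB /= fyE addrK.
exact: zX.
Qed.

(** A proper submodule of least codimension is maximal. *)
Lemma maximal_exists M : fullv != 0%VS :> {vspace M} ->
  exists X : submod M, rmaximal X.
Proof.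
move=> M0.
have [|X Xn Xmin] := @ex_argmin (submod M) (fun X => \dim {:M} - \dim X)%N
  (fun X => X != fullv :> {vspace M}).
  by exists (zero_submod M); rewrite eq_sym.
exists X; split=> // Y leXY.
have [Yf|Yn] := eqVneq (Y : {vspace M}) fullv; [by right | left].
apply/eqP; rewrite eq_sym eqEdim leXY /=.
have := Xmin _ Yn; rewrite leq_sub2lE //.
by rewrite dimvS // subvf.
Qed.

Lemma rquot_proj_rhom M (U : submod M) :
  @is_rhom K H M (rquot U) (rquot_proj U).
Proof. exact: rquot_projE. Qed.

Definition sub_val M (U : submod M) : 'Hom(rsub U, M) := linfun vsval.

Lemma sub_valE M (U : submod M) (x : rsub U) : sub_val U x = vsval x.
Proof. by rewrite lfunE. Qed.

Lemma sub_val_rhom M (U : submod M) : is_rhom (sub_val U).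
Proof. by move=> x h; rewrite !sub_valE. Qed.

Lemma rhom_comp M N P (g : 'Hom(N, P)) (f : 'Hom(M, N)) :
  is_rhom g -> is_rhom f -> is_rhom (g \o f)%VF.
Proof. by move=> gH fH x h; rewrite !comp_lfunE fH gH. Qed.

Lemma add_max M (X Y : submod M) :
  rmaximal X -> ~~ (Y <= X)%VS -> (Y + X)%VS = fullv.
Proof.
case=> _ Xmax nYX.
case: (Xmax (add_submod Y X)) => //= [|YX]; first exact: addvSr.
by case/negP: nYX; rewrite -YX addvSl.
Qed.

(** Equivalent to having a unique maximal submodule, in the form in which it is applied: an image
    that is not inside the radical is everything. *)
Definition rlocal M :=
  rrad M != fullv :> {vspace M} /\
  forall X : submod M, (X <= rrad M)%VS \/ X = fullv :> {vspace M}.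

(* A submodule N of least dimension outside a maximal submodule M is a direct
   summand: the projection P -> P / M lifts to an endomorphism g with image N
   that restricts to a bijection of N, by minimality. *)
Lemma projective_indecomposable_local P :
  rprojective P -> rindecomposable P -> rlocal P.
Proof.
move=> Pproj [P0 Pind].
have [M Mmax] := maximal_exists P0; have [Mn MmaxP] := Mmax.
(* This makes [M] the only maximal submodule, hence equal to the radical. *)
suff big (X : submod P) : ~~ (X <= M)%VS -> X = fullv :> {vspace P}.
  have radE : rrad P = M :> {vspace P}.
    apply/eqP; rewrite eqEsubv rrad_max //=; apply/subvP=> x xM.
    apply/vinfP=> _ [Y [Yn Ymax] ->].
    case: (boolP (Y <= M)%VS) => [leYM|/big YE]; last by rewrite YE eqxx in Yn.
    by have [ME|ME] := Ymax _ leYM; [rewrite -ME | rewrite ME eqxx in Mn].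
  split=> [|X]; rewrite radE //.
  by case: (boolP (X <= M)%VS) => [|/big]; [left | right].
pose Q (X : submod P) := ~~ (X <= M)%VS.
move=> nX.
have [|N nN Nmin] := @ex_argmin _ (fun X : submod P => \dim X) Q.
  by exists X.
suff NE : N = fullv :> {vspace P}.
  by apply/eqP; rewrite eqEdim subvf /= -NE; apply: Nmin.
have NM := add_max Mmax nN.
pose q : 'Hom(P, rquot M) := rquot_proj M.
have qE x : (q x == 0) = (x \in (M : {vspace P})) := rquot_proj_eq0 M x.
pose p : 'Hom(rsub N, rquot M) := (q \o sub_val N)%VF.
have pH : is_rhom p by apply: rhom_comp (@rquot_proj_rhom _ M) (@sub_val_rhom _ N).
have p_onto : limg p = fullv.
  apply/eqP; rewrite eqEsubv subvf; apply/subvP=> y _.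
  have : vsval y \in (N + M)%VS by rewrite NM memvf.
  case/memv_addP=> n nIN [z zM yE].
  apply/memv_imgP; exists (Subvs nIN); first exact: memvf.
  rewrite comp_lfunE sub_valE /= -[LHS](@rquot_proj_val _ _ P M) yE.
  rewrite -[LHS]/(q _) linearD /=.
  by move: zM; rewrite -qE => /eqP->; rewrite addr0.
have [g gH gq] := Pproj _ _ p q pH p_onto (@rquot_proj_rhom _ M).
pose G : 'End(P) := (sub_val N \o g)%VF.
have GH : is_rhom G by apply: rhom_comp (@sub_val_rhom _ N) gH.
have GN x : G x \in (N : {vspace P}) by rewrite comp_lfunE sub_valE subvsP.
have GM x : G x - x \in (M : {vspace P}).
  rewrite -qE linearB /=; apply/eqP.
  have -> : q x = p (g x) by rewrite -comp_lfunE gq.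
  by rewrite !comp_lfunE subrr.
(* [G] is the identity modulo [M], so the image of [N] is again outside [M] and minimality of [N]
   applies to it. *)
have GNN : (G @: N)%VS = N.
  apply/eqP; rewrite eqEdim; apply/andP; split.
    by apply/subvP=> _ /memv_imgP[x _ ->].
  apply: (Nmin (img_submod GH N)).
  have /subvPn[x xN xM] := nN; apply/subvPn; exists (G x); first exact: memv_img.
  by apply: contra xM => Gx; rewrite -[x](subKr (G x)) memvB.
have limgG : limg G = N.
  apply/eqP; rewrite eqEsubv; apply/andP; split.
    by apply/subvP=> _ /memv_imgP[x _ ->].
  by rewrite -GNN; apply: limgS; apply: subvf.
have NkerG : (N :&: lker G = 0)%VS.
  apply/eqP; rewrite -dimv_eq0; have := limg_ker_dim G N.
  by rewrite GNN -[RHS]add0n => /eqP; rewrite eqn_add2r.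
have kerG x h : x \in lker G -> x *> h \in lker G.
  by rewrite !memv_ker GH => /eqP->; rewrite ract0l.
have NkerG_full : (N + lker G = fullv)%VS.
  apply/eqP; rewrite eqEdim subvf dimv_disjoint_sum //= addnC.
  by have := limg_ker_dim G fullv; rewrite capfv limgG => ->.
case: (Pind N (Submod kerG)) => //= [N0|kerG0].
  by rewrite /Q N0 sub0v in nN.
by rewrite kerG0 addv0 in NkerG_full.
Qed.

End RightModuleTheory.

(** * The radical *)

Section Radical.
Variables (K : fieldType) (H : falgType K).
Implicit Types (M N P : rmod H).

Definition head_proj M : 'Hom(M, rhead M) := rquot_proj (rrad M).

Lemma head_proj_eq0 M x : (head_proj M x == 0) = (x \in (rrad M : {vspace M})).
Proof. exact: rquot_proj_eq0. Qed.

Lemma head_proj_rhom M : is_rhom (head_proj M).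
Proof. exact: rquot_projE. Qed.

(** The inclusion of the complement that carries the quotient: a linear section of [head_proj], in
    general not a module map. *)
Definition head_val M : 'Hom(rhead M, M) := linfun vsval.

Lemma head_valK M : cancel (head_val M) (head_proj M).
Proof. by move=> y; rewrite [head_val M y]lfunE; apply: rquot_proj_val. Qed.

Lemma rhead_simple M : rlocal M -> rsimple (rhead M).
Proof.
case=> radn Mloc; split.
  apply: contra radn => /eqP head0; rewrite eqEsubv subvf; apply/subvP=> x _.
  by rewrite -head_proj_eq0 -memv0 -head0 memvf.
move=> U; have [leU|UE] := Mloc (preim_submod (@head_proj_rhom M) U).
  left; apply/eqP; rewrite -subv0; apply/subvP=> y yU; rewrite memv0.
  rewrite -[y]head_valK head_proj_eq0 (subvP leU) // -memv_preim.
  by rewrite head_valK.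
right; apply/eqP; rewrite eqEsubv subvf; apply/subvP=> y _.
have : head_val M y \in (preim_submod (@head_proj_rhom M) U : {vspace M}).
  by rewrite UE memvf.
by rewrite -memv_preim head_valK.
Qed.

(** [F] need only be a module map modulo the radical: it then induces an endomorphism of the simple
    head, which is a scalar over a splitting field. The weaker hypothesis is what [pairing_socle]
    can provide. *)
Lemma schur_head M (F : 'End(M)) :
    splitting_field H -> rlocal M ->
    (forall x, x \in (rrad M : {vspace M}) -> F x \in (rrad M : {vspace M})) ->
    (forall x h, F (x *> h) - F x *> h \in (rrad M : {vspace M})) ->
  exists k : K, forall x, F x - k *: x \in (rrad M : {vspace M}).
Proof.
move=> split Mloc Frad FH; pose f := (head_proj M \o F \o head_val M)%VF.
have fE x : f (head_proj M x) = head_proj M (F x).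
  apply/eqP; rewrite !comp_lfunE -subr_eq0 -!linearB head_proj_eq0.
  by rewrite Frad // -head_proj_eq0 linearB /= head_valK subrr.
have fH : is_rhom f.
  move=> y h; rewrite -[y]head_valK -head_proj_rhom !fE -head_proj_rhom.
  by apply/eqP; rewrite -subr_eq0 -linearB head_proj_eq0.
have [k kE] := split _ (rhead_simple Mloc) _ fH.
exists k => x; rewrite -head_proj_eq0 linearB /= -fE kE linearZ /=.
by rewrite subrr.
Qed.

Lemma jrad_mulr (x h : H) : x \in jrad H -> x * h \in jrad H.
Proof. exact: (@submodP _ _ _ (rrad (regular H))). Qed.

Lemma ract_jrad M (u : M) (x : H) :
  x \in jrad H -> u *> x \in (rrad M : {vspace M}).
Proof.
rewrite -orbit_mapE; exact: (rhom_rad (@orbit_map_rhom _ _ M u)).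
Qed.

(** Left multiplication by [h] is an endomorphism of the right regular module, so the radical, built
    from right ideals only, is two-sided. *)
Lemma jrad_mull (h x : H) : x \in jrad H -> h * x \in jrad H.
Proof. exact: (@ract_jrad (regular H)). Qed.

Fact mul_jrad_subproof (I : submod (regular H)) (x : regular H) h :
  x \in (I * jrad H)%VS -> x *> h \in (I * jrad H)%VS.
Proof.
suff le : (I * jrad H <= amulr h @^-1: (I * jrad H))%VS.
  by move=> /(subvP le); rewrite -memv_preim lfunE.
apply/prodvP=> y z yI zJ; rewrite -memv_preim lfunE /= -mulrA.
by rewrite memv_mul // jrad_mulr.
Qed.

Definition mul_jrad (I : submod (regular H)) : submod (regular H) :=
  @Submod _ _ (regular H) _ (@mul_jrad_subproof I).

(** Nakayama's lemma: a nonzero [I], viewed as a module, has a maximal submodule, and this contains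
    the product of [I] with the radical. *)
Lemma mul_jrad_lt (I : submod (regular H)) :
  I != 0%VS :> {vspace H} -> (\dim (mul_jrad I) < \dim I)%N.
Proof.
move=> I0.
have I1 : fullv != 0%VS :> {vspace rsub I}.
  by rewrite -dimv_eq0 dimvf; rewrite -dimv_eq0 in I0.
have [X Xmax] := maximal_exists I1; have [Xn _] := Xmax.
have le : (mul_jrad I <= sub_val I @: X)%VS.
  apply/prodvP=> y z yI zJ; apply/memv_imgP.
  exists ((Subvs yI : rsub I) *> z); last by rewrite sub_valE.
  by apply: (subvP (rrad_max Xmax)); apply: ract_jrad.
apply: leq_ltn_trans (dimvS le) _.
have : (\dim X < \dim {:rsub I})%N.
  by rewrite ltnNge; apply: contra Xn; rewrite eqEdim subvf.
rewrite dimvf => ltX; apply: leq_ltn_trans ltX.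
by rewrite -(limg_ker_dim (sub_val I) X) leq_addl.
Qed.

Lemma jrad_nilpotent : exists a : nat, (jrad H ^+ a = 0)%VS.
Proof.
(* Stated for every right ideal so that the induction can pass from [I] to the smaller
   [mul_jrad I]. *)
have nilI n : forall I : submod (regular H), (\dim I <= n)%N ->
    ((I : {vspace H}) * jrad H ^+ n = 0)%VS.
  elim: n => [|n IHn] I dI.
    by move: dI; rewrite leqn0 dimv_eq0 => /eqP->; rewrite prod0v.
  have [I0|I0] := eqVneq (I : {vspace H}) 0%VS; first by rewrite I0 prod0v.
  rewrite expvSl prodvA; apply: (IHn (mul_jrad I)).
  by rewrite -ltnS; apply: leq_trans dI; apply: mul_jrad_lt.
exists (\dim {:H}); apply/eqP; rewrite -subv0.
rewrite -(nilI _ (full_submod (regular H)) (leqnn _)); apply/subvP=> x xJ.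
by rewrite -[x]mul1r memv_mul ?memvf.
Qed.

Lemma jrad_exp (x : H) n : x \in jrad H -> x ^+ n \in (jrad H ^+ n)%VS.
Proof.
move=> xJ; elim: n => [|n IHn]; first by rewrite memv_line.
by rewrite exprS expvSl memv_mul.
Qed.

(** The map is [x |-> p *> x]. Its image contains [p *> e], so locality makes it onto, and then the
    dimension bound makes it injective. *)
Lemma rideal_iso M (p : M) (e : H) :
    rlocal M -> p *> e \notin (rrad M : {vspace M}) ->
    (\dim (rideal e) <= \dim {:M})%N ->
  riso (rsub (rideal e)) M.
Proof.
move=> [_ Mloc] pe dim_le.
pose f : 'Hom(rsub (rideal e), M) := (orbit_map p \o sub_val (rideal e))%VF.
have fH : is_rhom f by apply: rhom_comp; [apply: orbit_map_rhom | apply: sub_val_rhom].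
have eI : e \in (rideal e : {vspace H}).
  by apply/memv_imgP; exists 1; rewrite ?memvf // lfunE /= mulr1.
have f_onto : limg f = fullv.
  case: (Mloc (img_submod fH (full_submod _))) => // le.
  case/negP: pe; apply: (subvP le); apply/memv_imgP; exists (Subvs eI).
    exact: memvf.
  rewrite comp_lfunE orbit_mapE; congr (_ *> _).
  by rewrite sub_valE.
have ker_f : lker f == 0%VS.
  rewrite -dimv_eq0 -(leqn0) -(leq_add2r (\dim (limg f))) add0n.
  by have := limg_ker_dim f fullv; rewrite capfv => ->; rewrite f_onto [X in (X <= _)%N]dimvf.
exists f; split=> //; exists (f^-1)%VF; first exact: lker0_lfunK.
by move=> y; apply: limg_lfunVK; rewrite f_onto memvf.
Qed.

End Radical.

(** The test forms are the coordinates of the projection onto a complement of [U]; all of them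
    vanish on [U]. *)
Lemma separating_functional (K : fieldType) (V : vectType K) (U : {vspace V}) x :
    (forall l : {scalar V}, (forall y, y \in U -> l y = 0) -> l x = 0) ->
  x \in U.
Proof.
move=> sep; have capUC : (U^C :&: U = 0)%VS by rewrite capvC capv_compl.
have xUC : x \in (U^C + U)%VS by rewrite addvC addv_complf memvf.
suff pi0 : daddv_pi (U^C)%VS U x = 0.
  by rewrite -(daddv_pi_add capUC xUC) pi0 add0r memv_pi.
rewrite [LHS](coord_vbasis (memvf _)); apply: big1 => i _.
rewrite -[coord _ i _]/((coord (vbasis {:V}) i \o daddv_pi (U^C)%VS U) x).
rewrite sep ?scale0r // => y yU /=.
suff -> : daddv_pi (U^C)%VS U y = 0 by rewrite linear0.
apply/eqP; rewrite -memv0 -(capv_compl U) memv_cap memv_pi andbT.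
have yUC : y \in (U^C + U)%VS by rewrite addvC addv_complf memvf.
have piU : y - daddv_pi U (U^C)%VS y \in U by rewrite memvB ?memv_pi.
by rewrite -(addrK (daddv_pi U (U^C)%VS y) (daddv_pi _ _ y)) daddv_pi_add.
Qed.

(** * Casimir elements *)

Section Casimir.
Variables (K : fieldType) (H : falgType K) (tau : {scalar H}).
Hypothesis frob : frobenius_form tau.
Variables (W : finType) (B Bd : W -> H).
Hypotheses (basisB : basis_family B) (dualB : dual_basis tau B Bd).

Lemma frob_injl (x y : H) : (forall h, tau (x * h) = tau (y * h)) -> x = y.
Proof.
move=> eq_xy; apply/eqP; rewrite -subr_eq0; apply/eqP/frob.1 => h.
by rewrite mulrBl linearB eq_xy subrr.
Qed.

Lemma eq_on_basis (A : W -> H) (f g : {scalar H}) :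
  basis_family A -> (forall w, f (A w) = g (A w)) -> f =1 g.
Proof.
move=> /span_basis spanA eq_fg h.
rewrite [h](@coord_span _ _ _ (in_tuple (codom A))) /= ?spanA ?memvf //.
rewrite !linear_sum; apply: eq_bigr => i _; rewrite !linearZ /=.
have /codomP[w ->] : (codom A)`_i \in codom A by rewrite mem_nth.
by rewrite eq_fg.
Qed.

Variable P : rmod H.
Implicit Types (k l : {scalar P}) (p u : P).

Definition theta_fun l p : H := \sum_w l (p *> B w) *: Bd w.

Fact theta_linear l : linear (theta_fun l).
Proof.
move=> a p q; rewrite /theta_fun scaler_sumr -big_split; apply: eq_bigr => w _.
by rewrite ract_linearl linearP scalerDl scalerA.
Qed.

HB.instance Definition _ l := GRing.isSemilinear.Build K P H _ (theta_fun l)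
  (GRing.semilinear_linear (theta_linear l)).

Definition theta l : 'Hom(P, regular H) := linfun (theta_fun l).

(** [theta_fun] with the two dual bases exchanged, so that [h] stands on the left in
    [tau_theta_dual]. The elements [E' i] of part (2) are multiples of such values. *)
Definition theta_dual l p : H := \sum_w l (p *> Bd w) *: B w.

Lemma tau_theta l p h : tau ((theta l p : H) * h) = l (p *> h).
Proof.
rewrite lfunE /=.
pose f : {scalar H} := tau \o amull (theta_fun l p).
pose g : {scalar H} := l \o ract p.
suff : f h = g h by rewrite /f /= lfunE.
apply: (eq_on_basis basisB) => v; rewrite /f /g /= lfunE /=.
rewrite /theta_fun mulr_suml linear_sum (bigD1 v) //= -scalerAl linearZ /=.
rewrite dualB.2 eqxx mulr1 big1 ?addr0 // => w nwv.
by rewrite -scalerAl linearZ /= dualB.2 (negPf nwv) mulr0.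
Qed.

Lemma tau_theta_dual l p h : tau (h * theta_dual l p) = l (p *> h).
Proof.
pose f : {scalar H} := tau \o amulr (theta_dual l p).
pose g : {scalar H} := l \o ract p.
suff : f h = g h by rewrite /f /= lfunE.
apply: (eq_on_basis dualB.1) => v; rewrite /f /g /= lfunE /=.
rewrite /theta_dual mulr_sumr linear_sum (bigD1 v) //= -scalerAr linearZ /=.
rewrite dualB.2 eqxx mulr1 big1 ?addr0 // => w nwv.
by rewrite -scalerAr linearZ /= dualB.2 eq_sym (negPf nwv) mulr0.
Qed.

Lemma theta_rhom l : is_rhom (theta l).
Proof.
move=> p g; apply: frob_injl => h; rewrite tau_theta -ractM -mulrA.
by rewrite tau_theta.
Qed.

(** Both sides expand to the sum over [w] of [k (u *> B w) * l (p *> Bd w)]. *)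
Lemma casimir_swap k l p u : k (u *> theta_dual l p) = l (p *> theta k u).
Proof.
rewrite lfunE /= /theta_fun /theta_dual !linear_sum.
by apply: eq_bigr => w _; rewrite !linearZ /= mulrC.
Qed.

Variables (alpha : {lrmorphism H -> H}).
Hypothesis nak : nakayama_automorphism tau alpha.

(** Moving [theta_dual l p] from the right to the left inside [tau] costs one application of
    [alpha]. *)
Lemma alpha_theta_dual l p : alpha (theta_dual l p) = theta l p.
Proof. by apply: frob_injl => h; rewrite -nak.2 tau_theta_dual tau_theta. Qed.

Hypotheses (split : splitting_field H).
Hypotheses (Pproj : rprojective P) (Ploc : rlocal P).

Variable T : 'End(P).
Hypotheses (Tker : forall p, (T p == 0) = (p \in (rrad P : {vspace P}))).
Hypotheses (Talpha : forall p h, T (p *> alpha h) = T p *> h).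

Lemma theta_rad l p : p \in (rrad P : {vspace P}) -> (theta l p : H) \in jrad H.
Proof. exact: (rhom_rad (@theta_rhom l)). Qed.

Definition pairing_map u l : 'End(P) := (orbit_map u \o theta l)%VF.

Lemma pairing_mapE u l p : pairing_map u l p = u *> theta l p.
Proof. by rewrite comp_lfunE orbit_mapE. Qed.

Lemma pairing_map_rhom u l : is_rhom (pairing_map u l).
Proof. by apply: rhom_comp; [apply: orbit_map_rhom | apply: theta_rhom]. Qed.

Lemma pairing_head u l :
  exists k : K, forall p, u *> theta l p - k *: p \in (rrad P : {vspace P}).
Proof.
have [||k kE] := schur_head (F := pairing_map u l) split Ploc.
- by move=> p; apply: rhom_rad; apply: pairing_map_rhom.
- by move=> p h; rewrite pairing_map_rhom subrr mem0v.
by exists k => p; rewrite -pairing_mapE.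
Qed.

(** Swapping gives [k (T u *> theta_dual l p)]; [Talpha] turns the argument of [k] into
    [T (u *> theta l p)], and [T] sees only the class modulo the radical. *)
Lemma casimir_head u l (c : K) k p :
    (forall p, u *> theta l p - c *: p \in (rrad P : {vspace P})) ->
  l (p *> theta k (T u)) = c * k (T p).
Proof.
move=> /(_ p); rewrite -Tker linearB linearZ subr_eq0 => /eqP TE.
by rewrite -casimir_swap -Talpha alpha_theta_dual TE linearZ.
Qed.

Lemma T_neq0 : exists p, T p != 0.
Proof.
have [radn _] := Ploc.
have /subvPn[p _] : ~~ (fullv <= rrad P)%VS.
  by apply: contra radn; rewrite eqEsubv subvf.
by rewrite -Tker; exists p.
Qed.

Variables (p0 : P) (k0 : {scalar P}).
Hypothesis Tp0 : k0 (T p0) = 1.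

(** By [casimir_head], a form [l] that vanishes on [limg T] takes here as value the head scalar of
    the pairing of [u] with [l]; this scalar has to be shown to be 0. *)
Lemma pairing_stable u : p0 *> theta k0 (T u) \in limg T.
Proof.
apply: separating_functional => l l0.
have [c cE] := pairing_head u l.
rewrite (casimir_head k0 p0 cE) Tp0 mulr1.
have [q Tq] := T_neq0.
have kill : pairing_map u l (T q) = 0.
  rewrite pairing_mapE; suff -> : theta l (T q) = 0 by rewrite linear0.
  apply: frob_injl => h; rewrite tau_theta mul0r linear0 l0 //.
  by rewrite -Talpha memv_img ?memvf.
(* If [c != 0], the image of the pairing map is not inside the radical, hence is all of [P]; the map
   is then injective by dimension, against [kill]. *)
have c0 : c = 0.
  have [radn rad_or] := Ploc.
  have [le|full] := rad_or (img_submod (@pairing_map_rhom u l) (full_submod P)).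
    have [//|nc] := eqVneq c 0; case/negP: radn.
    rewrite eqEsubv subvf; apply/subvP=> p _.
    have : c *: p \in (rrad P : {vspace P}).
      rewrite -[c *: p](subKr (u *> theta l p)) memvB //.
      by rewrite (subvP le) // -pairing_mapE memv_img ?memvf.
    by move/(memvZ c^-1); rewrite scalerA mulVf ?scale1r.
  case/eqP: Tq; apply/eqP; rewrite -memv0.
  suff /eqP <- : lker (pairing_map u l) == 0%VS by rewrite memv_ker kill.
  have := limg_ker_dim (pairing_map u l) fullv.
  rewrite capfv [X in (_ + \dim X)%N]full -[RHS]add0n => /eqP.
  by rewrite eqn_add2r dimv_eq0.
by rewrite c0.
Qed.

(** The constant of the theorem, once [p0] is [hi one] and [k0] is the coordinate form at
    [lo one]. *)
Let c := k0 (p0 *> theta k0 (T p0)).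

(** The pairing preserves [limg T], so it can be pulled back through [T] to a map [F] on [P], well
    defined modulo [rad P]. Schur's lemma on the head yields a scalar, and applying [k0] at [u = p0]
    identifies it as [c]. *)
Lemma pairing_socle u : p0 *> theta k0 (T u) = c *: T u.
Proof.
pose G := pairing_map p0 k0; pose F : 'End(P) := (T^-1 \o G \o T)%VF.
have TF v : T (F v) = p0 *> theta k0 (T v).
  by rewrite [F v]comp_lfunE comp_lfunE pairing_mapE limg_lfunVK ?pairing_stable.
have [|x h|k kE] := schur_head (F := F) split Ploc.
- by move=> x; rewrite -!Tker TF => /eqP->; rewrite !linear0.
- have [beta _ betaK] := nak.1.
  rewrite -Tker -[h]betaK linearB /= Talpha !TF Talpha theta_rhom.
  by rewrite -ractM subrr.
have GE v : p0 *> theta k0 (T v) = k *: T v.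
  by move: (kE v); rewrite -TF -Tker linearB linearZ subr_eq0 => /eqP.
by rewrite GE /c GE linearZ /= Tp0 mulr1.
Qed.

(** [casimir_head] at [k0] and [p0] gives the head scalar as [l (p0 *> theta k0 (T u))], which
    [pairing_socle] evaluates. *)
Lemma pairing_headE l u p :
  u *> theta l p - (c * l (T u)) *: p \in (rrad P : {vspace P}).
Proof.
have [k kE] := pairing_head u l.
suff -> : c * l (T u) = k by [].
by rewrite -linearZ -pairing_socle (casimir_head k0 p0 kE) Tp0 mulr1.
Qed.

Lemma p0_rad : p0 \notin (rrad P : {vspace P}).
Proof.
by rewrite -Tker; apply: contra_eq_neq Tp0 => ->; rewrite linear0 eq_sym oner_eq0.
Qed.

Lemma orbit_full p : p \notin (rrad P : {vspace P}) -> limg (orbit_map p) = fullv.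
Proof.
move=> np; have [_ rad_or] := Ploc.
have [le|//] := rad_or (img_submod (@orbit_map_rhom _ _ _ p) (full_submod _)).
case/negP: np; rewrite -[p]ract1 -orbit_mapE.
by rewrite (subvP le) // memv_img ?memvf.
Qed.

(* A section of h |-> p0 *> h is theta l for l = tau o s, so the pairing of p0
   with this l is the identity of P. *)
Lemma casimir_const_neq0 : c != 0.
Proof.
have id_hom : @is_rhom _ _ P P \1%VF by move=> x h; rewrite !id_lfunE.
have [s sH sE] := Pproj (@orbit_map_rhom _ _ _ p0) (orbit_full p0_rad) id_hom.
pose l : {scalar P} := tau \o (s : P -> H).
have sl p : theta l p = s p.
  by apply: frob_injl => h; rewrite tau_theta /= sH.
apply/eqP => c0; have [/negP[]] := Ploc.
rewrite eqEsubv subvf; apply/subvP=> p _.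
have := pairing_headE l p0 p; rewrite c0 mul0r scale0r subr0 sl.
by rewrite -orbit_mapE -comp_lfunE sE id_lfunE.
Qed.

End Casimir.

(** * Lifting idempotents *)

Section LiftPoly.

(** For [s <= a] the exponent [2 * a - s] is at least [a]. *)
Lemma lift_polyX a : exists q, lift_poly a = 'X^a * q.
Proof.
exists (\sum_(0 <= s < a.+1) ('X^(a - s) * (1 - 'X) ^+ s) *+ 'C(2 * a, s)).
rewrite /lift_poly mulr_sumr !big_mkord; apply: eq_bigr => s _.
rewrite mulrnAr mulrA -exprD addnBA; last by rewrite -ltnS.
by rewrite mul2n addnn.
Qed.

(** The full expansion of [('X + (1 - 'X)) ^+ (2 * a)] is 1, and the terms missing from
    [lift_poly a] are those with [s > a]. *)
Lemma lift_poly1X a : exists r, 1 - lift_poly a = (1 - 'X) ^+ a.+1 * r.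
Proof.
exists (\sum_(a.+1 <= s < (2 * a).+1)
  ('X^(2 * a - s) * (1 - 'X) ^+ (s - a.+1)) *+ 'C(2 * a, s)).
have sum1 : \sum_(0 <= s < (2 * a).+1)
    ('X^(2 * a - s) * (1 - 'X) ^+ s) *+ 'C(2 * a, s) = 1 :> {poly int}.
  by rewrite big_mkord -exprDn addrC subrK expr1n.
rewrite -[X in X - _]sum1 /lift_poly (big_cat_nat _ (n := a.+1)) //=; last first.
  by rewrite ltnS mul2n -addnn leq_addr.
rewrite addrAC subrr add0r mulr_sumr; apply: eq_big_nat => s /andP[le_as _].
by rewrite mulrnAr mulrCA -exprD subnKC.
Qed.

Variables (K : fieldType) (H : falgType K).
Implicit Types x : H.

(** Integers are central, so evaluation at a point of the noncommutative [H] is still a ring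
    morphism on integer polynomials. *)
Fact intr_comm x : commr_rmorph (intr : int -> H) x.
Proof. by move=> k; apply: commr_int. Qed.

Lemma poly_evalE (f : {poly int}) x :
  poly_eval f x = horner_morph (intr_comm x) f.
Proof. by []. Qed.

Lemma eval_X x : horner_morph (intr_comm x) 'X = x.
Proof. exact: horner_morphX. Qed.

Lemma lift_poly_factor a x : (0 < a)%N -> exists t : H,
  poly_eval (lift_poly a) x = x * t /\ poly_eval (lift_poly a) x = t * x.
Proof.
case: a => // a _; have [q ->] := lift_polyX a.+1.
exists (poly_eval ('X^a * q) x).
split; [rewrite exprS -mulrA | rewrite exprS -mulrA mulrC];
by rewrite !poly_evalE rmorphM /= eval_X.
Qed.

(** The two factorisations make [f * (1 - f)] a multiple of [('X * (1 - 'X)) ^+ a], whose value at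
    [x] lies in the vanishing power of the radical. *)
Lemma lift_poly_idem a x :
    (jrad H ^+ a = 0)%VS -> x * (1 - x) \in jrad H ->
  poly_eval (lift_poly a) x ^+ 2 = poly_eval (lift_poly a) x.
Proof.
move=> Ja xJ; set f := lift_poly a.
have [q qE] := lift_polyX a; have [r rE] := lift_poly1X a.
have fE : f * (1 - f) = ('X * (1 - 'X)) ^+ a * (q * (1 - 'X) * r).
  by rewrite rE /f qE exprMn exprSr; ring.
apply/eqP; rewrite eq_sym -subr_eq0 expr2 -{1}[poly_eval f x]mulr1 -mulrBr.
have -> : 1 - poly_eval f x = poly_eval (1 - f) x.
  by rewrite !poly_evalE rmorphB rmorph1.
rewrite !poly_evalE -rmorphM fE rmorphM rmorphXn rmorphM rmorphB rmorph1.
rewrite /= eval_X; have := jrad_exp a xJ.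
by rewrite Ja memv0 => /eqP->; rewrite mul0r.
Qed.

Lemma lift_poly_modJ a x :
    (0 < a)%N -> x * (1 - x) \in jrad H ->
  poly_eval (lift_poly a) x - x \in jrad H.
Proof.
case: a => // a _ xJ; set f := lift_poly a.+1.
have [q qE] := lift_polyX a.+1; have [r rE] := lift_poly1X a.+1.
have fE : f - 'X = ('X * (1 - 'X)) * ('X^a * q - (1 - 'X) ^+ a.+1 * r).
  (* In this splitting [1 - f] supplies a factor [1 - 'X] and [f - 'X] a factor ['X], so each
     summand is divisible by ['X * (1 - 'X)]. *)
  transitivity ('X * ((1 - 'X) - (1 - f)) + (1 - 'X) * (f - 'X)); first by ring.
  rewrite rE /f qE !exprS; ring.
have -> : poly_eval f x - x = poly_eval (f - 'X) x.
  by rewrite !poly_evalE rmorphB /= eval_X.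
rewrite fE !poly_evalE rmorphM rmorphM rmorphB rmorph1 /= eval_X.
exact: jrad_mulr.
Qed.

Lemma poly_eval_morph (alpha : {lrmorphism H -> H}) (f : {poly int}) x :
  alpha (poly_eval f x) = poly_eval f (alpha x).
Proof.
rewrite /poly_eval -horner_map -map_poly_comp; congr (_.[_]).
by apply: eq_map_poly => k /=; rewrite rmorph_int.
Qed.

End LiftPoly.

(** * Transport of right ideals and of the radical along an algebra automorphism *)

Section Automorphism.
Variables (K : fieldType) (H : falgType K) (alpha : {lrmorphism H -> H}).
Hypothesis alpha_bij : bijective alpha.

Let f : 'End(H) := linfun alpha.

Lemma right_ideal_mulr (X : submod (regular H)) (x h : H) :
  x \in (X : {vspace H}) -> x * h \in (X : {vspace H}).
Proof. exact: (@submodP _ _ (regular H) X). Qed.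

Lemma ker_automorphism : lker f == 0%VS.
Proof. by apply/lker0P=> x y; rewrite !lfunE; apply: bij_inj. Qed.

Fact img_alpha_subproof (X : submod (regular H)) (x : regular H) (h : H) :
  x \in (f @: X)%VS -> x *> h \in (f @: X)%VS.
Proof.
case/memv_imgP=> y yX ->; have [beta _ betaK] := alpha_bij.
have -> : (f y : regular H) *> h = f (y * beta h).
  by rewrite !lfunE /= rmorphM; congr (_ * _); rewrite [RHS]betaK.
by rewrite memv_img // right_ideal_mulr.
Qed.

Definition img_alpha X : submod (regular H) :=
  @Submod _ _ (regular H) _ (@img_alpha_subproof X).

Fact preim_alpha_subproof (X : submod (regular H)) (x : regular H) (h : H) :
  x \in (f @^-1: X)%VS -> x *> h \in (f @^-1: X)%VS.
Proof.
rewrite -!memv_preim !lfunE /= rmorphM.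
exact: right_ideal_mulr.
Qed.

Definition preim_alpha X : submod (regular H) :=
  @Submod _ _ (regular H) _ (@preim_alpha_subproof X).

(** An automorphism maps maximal right ideals to maximal right ideals: a right ideal above the image
    of [X] is compared with [X] through its preimage. *)
Lemma jrad_automorphism x : alpha x \in jrad H -> x \in jrad H.
Proof.
move=> xJ; apply/vinfP=> _ [X [Xn Xmax] ->].
suff /rrad_max/subvP/(_ _ xJ) : rmaximal (img_alpha X).
  case/memv_imgP=> y yX; rewrite lfunE => /(bij_inj alpha_bij) ->.
  exact: yX.
have imgf : limg f = fullv := lker0_limgf ker_automorphism.
split=> [|Z leZ].
  apply: contra Xn => /eqP XE; rewrite eqEsubv subvf; apply/subvP=> y _.
  have : f y \in (img_alpha X : {vspace H}) by rewrite XE memvf.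
  by case/memv_imgP=> z zX; rewrite !lfunE => /(bij_inj alpha_bij) ->.
have fK : (f @: (f @^-1: Z))%VS = Z by rewrite lpreimK // imgf subvf.
have le : (X <= preim_alpha Z)%VS.
  by apply/subvP=> y yX; rewrite -memv_preim (subvP leZ) // memv_img.
have [ZE|ZE] := Xmax _ le; [left | right]; rewrite -fK.
  by rewrite [(f @^-1: Z)%VS]ZE.
by rewrite [(f @^-1: Z)%VS]ZE imgf.
Qed.

Lemma dim_rideal_alpha e : (\dim (rideal e) <= \dim (rideal (alpha e)))%N.
Proof.
have dimf : \dim (f @: limg (amull e)) = \dim (limg (amull e)).
  by apply: limg_dim_eq; rewrite (eqP ker_automorphism) capv0.
rewrite -[X in (X <= _)%N]dimf.
apply: dimvS; apply/subvP=> _ /memv_imgP[_ /memv_imgP[y _ ->] ->].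
by rewrite !lfunE /= rmorphM; apply/memv_imgP; exists (alpha y); rewrite ?memvf // lfunE.
Qed.

End Automorphism.

(** * Adapted bases *)

Lemma mem_take_basis (K : fieldType) (V : vectType K) n (b : n.-tuple V) k v :
    basis_of {:V} b ->
  v \in <<take k b>>%VS <-> (forall i : 'I_n, (k <= i)%N -> coord b i v = 0).
Proof.
move=> bV; have bfree := basis_free bV; split=> [vk i le_ki|v0].
  rewrite (@coord_span _ _ _ (in_tuple (take k b)) v) // linear_sum big1 // => j _.
  have /andP[jk jn] : (j < k)%N && (j < n)%N.
    have := leq_trans (ltn_ord j) (eq_leq (size_take_min k b)).
    by rewrite leq_min size_tuple.
  rewrite linearZ /= nth_take // -[b`_j]/(b`_(Ordinal jn)) coord_free //.
  by rewrite -val_eqE /= ltn_eqF ?mulr0 //; apply: leq_trans jk le_ki.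
rewrite [v](coord_basis bV (memvf _)) memv_suml // => i _.
case: (ltnP i k) => [lt_ik|/v0->]; last by rewrite scale0r mem0v.
rewrite memvZ // memv_span // -(nth_take 0 lt_ik) mem_nth //.
by rewrite size_take_min leq_min lt_ik size_tuple ltn_ord.
Qed.

Section AdaptedBasis.
Variables (K : fieldType) (H : falgType K) (alpha : {lrmorphism H -> H}).
Variables (P : rmod H) (m d : nat) (b : (m + d).-tuple P).

Let lo (i : 'I_d) := tnth b (lo_idx m i).
Let hi (i : 'I_d) := tnth b (hi_idx m i).

(* Induces the isomorphism from the twist of the head by alpha to the socle. *)
Definition socle_fun (p : P) : P := \sum_i coord b (hi_idx m i) p *: lo i.

Fact socle_linear : linear socle_fun.
Proof.
move=> a p q; rewrite /socle_fun scaler_sumr -big_split; apply: eq_bigr => i _.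
by rewrite linearP scalerDl scalerA.
Qed.

HB.instance Definition _ := GRing.isSemilinear.Build K P P _ socle_fun
  (GRing.semilinear_linear socle_linear).

Definition socle_map : 'End(P) := linfun socle_fun.

Hypothesis adapted : adapted_basis alpha b.

Lemma coord_hi_hi i j : coord b (hi_idx m i) (hi j) = (i == j)%:R.
Proof.
by case: adapted => bP _ _ _; rewrite /hi (tnth_nth 0) coord_free ?(basis_free bP) //
  (inj_eq (@rshift_inj _ _)) eq_sym.
Qed.

Lemma coord_lo_lo i j : coord b (lo_idx m i) (lo j) = (i == j)%:R.
Proof.
by case: adapted => bP _ _ _; rewrite /lo (tnth_nth 0) coord_free ?(basis_free bP) //
  -val_eqE eq_sym.
Qed.

Lemma socle_hi i : socle_map (hi i) = lo i.
Proof.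
rewrite lfunE /= /socle_fun (bigD1 i) //= coord_hi_hi eqxx scale1r.
by rewrite big1 ?addr0 // => j nji; rewrite coord_hi_hi (negPf nji) scale0r.
Qed.

Lemma mem_rad p :
  p \in (rrad P : {vspace P}) <-> forall i, coord b (hi_idx m i) p = 0.
Proof.
case: adapted => bP _ /span_basis <- _; rewrite (mem_take_basis _ _ bP).
split=> [p0 i|p0 i]; first by apply: p0; rewrite leq_addr.
by case: (splitP i) => // [j ij|j ij _]; [rewrite ij leqNgt ltn_ord |
  rewrite -(p0 j); congr (coord b _ p); apply: val_inj].
Qed.

Lemma lo_free (k : 'I_d -> K) : \sum_i k i *: lo i = 0 -> forall i, k i = 0.
Proof.
move=> /(congr1 (coord b (lo_idx m _))) k0 i; have := k0 i.
rewrite linear0 linear_sum (bigD1 i) //= linearZ /= coord_lo_lo eqxx mulr1.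
rewrite big1 ?addr0 // => j nji.
by rewrite linearZ /= coord_lo_lo eq_sym (negPf nji) mulr0.
Qed.

Lemma socle_map_eq0 p : (socle_map p == 0) = (p \in (rrad P : {vspace P})).
Proof.
rewrite lfunE; apply/eqP/idP=> [/lo_free/mem_rad|/mem_rad p0] //.
by rewrite /= /socle_fun big1 // => i _; rewrite p0 scale0r.
Qed.

Lemma soc_expand p : p \in (rsoc P : {vspace P}) ->
  p = \sum_i coord b (lo_idx m i) p *: lo i.
Proof.
case: adapted => bP /span_basis <- _ _ /(mem_take_basis _ _ bP) p0.
rewrite {1}[p](coord_basis bP (memvf _)).
rewrite (bigID (fun i : 'I_(m + d) => (i < d)%N)) /= addrC big1 ?add0r; last first.
  by move=> i; rewrite -leqNgt => /p0->; rewrite scale0r.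
rewrite big_ord_narrow ?leq_addl // => le_d; apply: eq_bigr => i _.
by rewrite /lo (tnth_nth 0) /lo_idx (bool_irrelevance le_d (leq_addl m d)).
Qed.

Lemma lo_soc i : lo i \in (rsoc P : {vspace P}).
Proof.
case: adapted => bP /span_basis <- _ _; apply/(mem_take_basis _ _ bP) => j le_dj.
rewrite /lo (tnth_nth 0) coord_free ?(basis_free bP) //.
by case: eqP => // ij; move: le_dj; rewrite -ij /= leqNgt ltn_ord.
Qed.

Lemma limg_socle_map : limg socle_map = rsoc P.
Proof.
apply/eqP; rewrite eqEsubv; apply/andP; split; apply/subvP=> p.
  case/memv_imgP=> q _ ->; rewrite lfunE /= memv_suml // => i _.
  by rewrite memvZ // lo_soc.
move/soc_expand->; rewrite memv_suml // => i _.
by rewrite memvZ // -socle_hi memv_img ?memvf.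
Qed.

(** On the vectors [hi i] this is, coordinate by coordinate, the last adaptedness condition. A
    general [p] differs from a combination [p'] of these by an element of the radical, which
    contributes 0 to both sides. *)
Lemma socle_map_alpha p h : socle_map (p *> alpha h) = socle_map p *> h.
Proof.
have hiE i : socle_map (hi i *> alpha h) = lo i *> h.
  rewrite [RHS]soc_expand ?submodP ?lo_soc // lfunE /=; apply: eq_bigr => j _.
  by case: adapted => _ _ _ ->.
pose p' := \sum_i coord b (hi_idx m i) p *: hi i.
have radp : p - p' \in (rrad P : {vspace P}).
  apply/mem_rad => i; rewrite linearB linear_sum (bigD1 i) //= linearZ /=.
  rewrite coord_hi_hi eqxx mulr1 big1 ?addr0 ?subrr // => j nji.
  by rewrite linearZ /= coord_hi_hi eq_sym (negPf nji) mulr0.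
have -> : socle_map p = socle_map p'.
  by apply/eqP; rewrite -subr_eq0 -linearB socle_map_eq0.
have -> : socle_map (p *> alpha h) = socle_map (p' *> alpha h).
  by apply/eqP; rewrite -subr_eq0 -linearB -ractBl socle_map_eq0 submodP.
rewrite ract_suml !linear_sum ract_suml; apply: eq_bigr => i _.
by rewrite ractZl !linearZ /= ractZl hiE socle_hi.
Qed.

End AdaptedBasis.

(** * Projective modules that map onto the socle *)

Section TwistedSocle.
Variables (K : fieldType) (H : falgType K) (alpha : {lrmorphism H -> H}).
Hypothesis alpha_bij : bijective alpha.
Variables (P : rmod H) (Ploc : rlocal P) (T : 'End(P)).
Hypotheses (Tker : forall p, (T p == 0) = (p \in (rrad P : {vspace P}))).
Hypotheses (Talpha : forall p h, T (p *> alpha h) = T p *> h).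
Variables (S : submod P) (limgT : limg T = S).
Variables (p0 : P) (p0_nrad : p0 \notin (rrad P : {vspace P})).

Lemma T_orbit y : y \in (S : {vspace P}) -> exists h, y = T p0 *> h.
Proof.
rewrite -limgT => /memv_imgP[p _ ->].
have : p \in limg (orbit_map p0) by rewrite (orbit_full Ploc p0_nrad) memvf.
case/memv_imgP=> h _ ->; have [beta _ betaK] := alpha_bij.
by exists (beta h); rewrite -Talpha betaK orbit_mapE.
Qed.

(* A lift g : Q -> H of pi through h |-> T p0 *> h satisfies
   T (p0 *> alpha (g q)) = pi q, so q |-> p0 *> alpha (g q) is onto P. *)
Lemma dim_le_projective (Q : rmod H) (pi : 'Hom(Q, rsub S)) :
  rprojective Q -> is_rhom pi -> limg pi = fullv ->
  (\dim {:P} <= \dim {:Q})%N.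
Proof.
move=> Qproj piH pi_onto.
have TS h : T p0 *> h \in (S : {vspace P}) by rewrite submodP // -limgT memv_img ?memvf.
pose f : 'Hom(regular H, rsub S) := (linfun (vsproj S) \o orbit_map (T p0))%VF.
have fE h : vsval (f h) = T p0 *> h.
  by rewrite comp_lfunE lfunE /= orbit_mapE vsprojK.
have fH : is_rhom f.
  by move=> g h; apply: val_inj; rewrite /= -![val _]/(vsval _) !fE ractM.
have f_onto : limg f = fullv.
  apply/eqP; rewrite eqEsubv subvf; apply/subvP=> y _.
  have [h yE] := T_orbit (subvsP y).
  apply/memv_imgP; exists h; first exact: memvf.
  by apply: val_inj; rewrite -![val _]/(vsval _) fE.
have [g gH fg] := Qproj _ _ f pi fH f_onto piH.
pose w : 'Hom(Q, P) := (orbit_map p0 \o (linfun alpha \o g))%VF.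
have wE q : w q = p0 *> alpha (g q).
  by rewrite !comp_lfunE orbit_mapE lfunE.
have wH q h : w q *> alpha h = w (q *> h).
  by rewrite !wE gH /= rmorphM ractM.
have Tw q : T (w q) = vsval (pi q).
  by rewrite wE Talpha -fE -comp_lfunE fg.
(* [w] is only semilinear along [alpha], but its image is a submodule because [alpha] is onto. *)
have wP x h : x \in limg w -> x *> h \in limg w.
  case/memv_imgP=> q _ ->; have [beta _ betaK] := alpha_bij.
  by rewrite -[h]betaK wH memv_img ?memvf.
have w_onto : limg w = fullv.
  have [_ /(_ (Submod wP)) [/= le|//]] := Ploc.
  have : Subvs (TS 1) \in limg pi by rewrite pi_onto memvf.
  case/memv_imgP=> q _ qE; have := subvP le _ (memv_img w (memvf q)).
  rewrite -Tker Tw -qE /= ract1 => Tp0.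
  by case/negP: p0_nrad; rewrite -Tker.
rewrite -w_onto; have := limg_ker_dim w fullv; rewrite capfv => <-.
exact: leq_addl.
Qed.

End TwistedSocle.

Theorem theorem14 (K : fieldType) (H : falgType K) (tau : {scalar H})
    (frob : frobenius_form tau) (split : splitting_field H)
    (alpha : {lrmorphism H -> H}) (nak : nakayama_automorphism tau alpha)
    (P : rmod H) (projP : rprojective P) (indecP : rindecomposable P)
    (m d : nat) (dimV : \dim {: rhead P} = d) (dimS : \dim (rsoc P) = d)
    (dimP : \dim {: P} = (m + d)%N)
    (b : (m + d).-tuple P) (adapted : adapted_basis alpha b)
    (one : 'I_d) (one_first : one = 0%N :> nat)
    (W : finType) (B Bd : W -> H) (basisB : basis_family B)
    (dualB : dual_basis tau B Bd) :
  let lo i := tnth b (lo_idx m i) in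
  let hi i := tnth b (hi_idx m i) in
  let lo_dual i (x : P) : K := coord b (lo_idx m i) x in
  let c : K :=
    \sum_(w : W) lo_dual one (lo one *> B w) * lo_dual one (hi one *> Bd w) in
  let e' (i : 'I_d) : H :=
    c^-1 *: \sum_(w : W) lo_dual i (hi i *> B w) *: Bd w in
  let E' (i : 'I_d) : H :=
    c^-1 *: \sum_(w : W) lo_dual i (hi i *> Bd w) *: B w in
  let part1 (f : {poly int}) :=
    let e i := poly_eval f (e' i) in
    (forall i, e i ^+ 2 = e i /\ riso (rsub (rideal (e i))) P) /\
    (forall i i', i != i' -> e i * e i' \in jrad H) in
  let part2 (f : {poly int}) :=
    let E i := poly_eval f (E' i) in
    forall Pbar : rmod H, rprojective Pbar -> rindecomposable Pbar ->
    riso (rhead Pbar) (rsub (rsoc P)) ->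
    (forall i, E i ^+ 2 = E i /\ riso (rsub (rideal (E i))) Pbar) /\
    (forall i i', i != i' -> E i * E i' \in jrad H) in
  [/\ c != 0,
      exists f : {poly int}, part1 f /\ part2 f
    & forall a : nat, (0 < a)%N -> (jrad H ^+ a = 0)%VS ->
      part1 (lift_poly a) /\ part2 (lift_poly a)].
Proof.
move=> lo hi lo_dual c e' E' part1 part2.
have Ploc := projective_indecomposable_local projP indecP.
have alpha_bij := nak.1.
pose T := socle_map b.
have Tker : forall p, (T p == 0) = (p \in (rrad P : {vspace P})).
  exact: socle_map_eq0 adapted.
have Talpha : forall p h, T (p *> alpha h) = T p *> h.
  exact: socle_map_alpha adapted.
have Thi i : T (hi i) = lo i := socle_hi adapted i.
pose l i : {scalar P} := coord b (lo_idx m i).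
have lT i j : l i (T (hi j)) = (i == j)%:R by rewrite Thi; apply: coord_lo_lo adapted _ _.
pose th i := theta B Bd (l i).
pose X i : H := th i (hi i).
(* Identifies [c] with the constant of the Casimir section for [p0 = hi one] and [k0 = l one]. *)
have cE : c = l one (hi one *> th one (T (hi one))).
  rewrite Thi /th lfunE /= /theta_fun !linear_sum; apply: eq_bigr => w _.
  by rewrite !linearZ.
have lT1 : l one (T (hi one)) = 1 by rewrite lT eqxx.
have c0 : c != 0.
  rewrite cE.
  exact: (casimir_const_neq0 frob basisB dualB nak split projP Ploc Tker Talpha lT1).
have headE i u p : u *> th i p - (c * l i (T u)) *: p \in (rrad P : {vspace P}).
  rewrite cE.
  exact: (pairing_headE frob basisB dualB nak split Ploc Tker Talpha lT1).
have e'E i : e' i = c^-1 *: X i by rewrite /X /th lfunE.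
have alphaE i : alpha (E' i) = e' i.
  rewrite e'E /X /th -(alpha_theta_dual frob basisB dualB nak) -linearZ.
  by [].
(* Right linearity of [th i] moves [X j] inside, and [headE] gives [hi i *> X j] modulo [rad P],
   which [th i] maps into the radical of [H]. *)
have XX i j : X i * X j - (c * (j == i)%:R) *: X i \in jrad H.
  have -> : X i * X j = th i (hi i *> X j) :> H.
    by rewrite /th (theta_rhom frob basisB dualB).
  have -> : (c * (j == i)%:R) *: X i = th i ((c * l j (T (hi i))) *: hi j) :> H.
    rewrite lT linearZ /=; case: eqP => [->|] //.
    by rewrite mulr0 !scale0r.
  by rewrite -linearB; apply: (theta_rad frob basisB dualB); apply: headE.
have e'e' i j : i != j -> e' i * e' j \in jrad H.
  move=> nij; have := XX i j; rewrite eq_sym (negPf nij) mulr0 scale0r subr0.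
  by move=> XJ; rewrite !e'E -scalerAl -scalerAr !memvZ.
have e'J i : e' i * (1 - e' i) \in jrad H.
  have := XX i i; rewrite eqxx mulr1 => XJ.
  rewrite mulrBr mulr1 !e'E -scalerAl -scalerAr -memvN opprB.
  rewrite [X in _ - X](_ : _ = c^-1 *: (c^-1 *: (c *: X i))); last by rewrite scalerK.
  by rewrite -!scalerBr !memvZ.
have hi_rad i : hi i \notin (rrad P : {vspace P}).
  apply/negP; rewrite -Tker => /eqP Ti; have := lT i i.
  by rewrite Ti linear0 eqxx => /esym/eqP; rewrite oner_eq0.
have main a : (0 < a)%N -> (jrad H ^+ a = 0)%VS ->
    part1 (lift_poly a) /\ part2 (lift_poly a).
  move=> a_gt0 Ja.
  pose f := lift_poly a.
  have fidem i := lift_poly_idem Ja (e'J i).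
  (* [e' i] fixes [hi i] modulo [rad P], and [f (e' i)] agrees with [e' i] modulo the radical of
     [H]. *)
  have hi_e i : hi i *> poly_eval f (e' i) \notin (rrad P : {vspace P}).
    apply: contra (hi_rad i) => hie.
    have hie' : hi i *> e' i - hi i \in (rrad P : {vspace P}).
      have := headE i (hi i) (hi i); rewrite lT eqxx mulr1 => /(memvZ c^-1).
      by rewrite scalerBr scalerK // e'E linearZ.
    have := ract_jrad (hi i) (lift_poly_modJ a_gt0 (e'J i)).
    rewrite linearB /= => he; rewrite -[hi i](subKr (hi i *> e' i)) memvB //.
    by rewrite -[hi i *> e' i](subKr (hi i *> poly_eval f (e' i))) memvB.
  (* [f (e' i)] has [e' i] as left factor, so its right ideal lies in the image of [P] under
     [th i]. *)
  have dim_e i : (\dim (rideal (poly_eval f (e' i))) <= \dim {:P})%N.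
    have [t [-> _]] := lift_poly_factor (e' i) a_gt0.
    have le : (rideal (e' i * t)%R <= limg (th i))%VS.
      apply/subvP=> _ /memv_imgP[y _ ->]; rewrite lfunE /= -mulrA.
      rewrite e'E -scalerAl memvZ //.
      have -> : X i * (t * y) = th i (hi i *> (t * y)).
        by rewrite /th (theta_rhom frob basisB dualB).
      by rewrite memv_img ?memvf.
    apply: leq_trans (dimvS le) _.
    by have := limg_ker_dim (th i) fullv; rewrite capfv => <-; apply: leq_addl.
  have ee i j : i != j -> poly_eval f (e' i) * poly_eval f (e' j) \in jrad H.
    move=> nij; have [t [_ ->]] := lift_poly_factor (e' i) a_gt0.
    have [s [-> _]] := lift_poly_factor (e' j) a_gt0.
    by rewrite mulrA jrad_mulr // -mulrA jrad_mull // e'e'.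
  split.
    split=> [i|i j nij]; last exact: ee.
    by split; [exact: fidem | apply: rideal_iso (hi_e i) (dim_e i)].
  (* All claims of part (2) except the isomorphism are pulled back through [alpha] from part (1). *)
  have alphaf i : alpha (poly_eval f (E' i)) = poly_eval f (e' i).
    by rewrite poly_eval_morph alphaE.
  move=> Pbar projQ indQ [g [gH g_bij]].
  have Qloc := projective_indecomposable_local projQ indQ.
  split=> [i|i j nij]; last first.
    by apply: (jrad_automorphism alpha_bij); rewrite rmorphM /= !alphaf ee.
  split; first by apply: (bij_inj alpha_bij); rewrite rmorphXn /= !alphaf fidem.
  pose pi : 'Hom(Pbar, rsub (rsoc P)) := (g \o head_proj Pbar)%VF.
  have piH : is_rhom pi by apply: rhom_comp gH (@head_proj_rhom _ _ Pbar).
  have pi_onto : limg pi = fullv.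
    apply/eqP; rewrite eqEsubv subvf; apply/subvP=> y _.
    have [g' _ g'K] := g_bij; apply/memv_imgP.
    exists (head_val Pbar (g' y)); first exact: memvf.
    by rewrite comp_lfunE head_valK g'K.
  (* A preimage [q] of [lo i] under [pi] serves as generator: [pi] maps [q *> E i] to [lo i *> E i],
     which is [T (hi i *> e i)] and hence nonzero. *)
  have : Subvs (lo_soc adapted i) \in limg pi by rewrite pi_onto memvf.
  case/memv_imgP=> q _ qE.
  apply: (@rideal_iso _ _ Pbar q) => //.
    apply/negP; rewrite -head_proj_eq0 => /eqP qe0.
    have : pi (q *> poly_eval f (E' i)) = 0 by rewrite comp_lfunE qe0 linear0.
    rewrite piH -qE => /(congr1 vsval) /= loE0.
    by case/negP: (hi_e i); rewrite -Tker -alphaf Talpha Thi; apply/eqP.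
  (* The chain of bounds runs from [E i H] through [e i H] and [P] to [Pbar]. *)
  apply: leq_trans (dim_rideal_alpha alpha_bij _) _; rewrite alphaf.
  apply: leq_trans (dim_e i) _.
  apply: (dim_le_projective alpha_bij Ploc Tker Talpha _ (hi_rad i) projQ piH pi_onto).
  exact: limg_socle_map adapted.
split=> //; have [a Ja] := jrad_nilpotent H.
(* The successor guarantees a positive exponent. *)
exists (lift_poly a.+1); apply: main => //.
by rewrite expvSl Ja prodv0.
Qed.
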